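(* Let $V$ be a finite set with $|V|\ge 2$ and let $\mathcal{P}=(P_t)_{t\ge1}$ be a sequence of irreducible, reversible and lazy transition matrices on $V$ which all have the same stationary distribution $\pi$. Let $(X_t)_{t\ge0}$ be a random walk according to $\mathcal{P}$ such that $X_0$ is sampled from $\pi$. Then, for any sequence of vertices $(w_t)_{t\ge0}$ in $V$ and any integer $T\ge0$, $$\Pr\left[\bigwedge_{t=0}^T\{X_t\ne w_t\}\right]\le\prod_{t=1}^T\left(1-\frac{1}{t_{\mathrm{hit}}(P_t)}\right)\le\exp\left(-\frac{T}{t_{\mathrm{HIT}}(\mathcal{P})}\right).$$
   Context: A transition matrix $P\in[0,1]^{V\times V}$ is a row-stochastic matrix. It is irreducible if for all $u,v$ there is $t>0$ with $P^t(u,v)>0$; lazy if $P(v,v)\ge1/2$ for all $v$; reversible if $\pi(u)P(u,v)=\pi(v)P(v,u)$ for all $u,v$, where $\pi$ is its stationary distribution. A random walk according to $\mathcal{P}$ is a time-inhomogeneous Markov chain $(X_t)_{t\ge0}$ with $\Pr[X_t=v\mid X_{t-1}=u]=P_t(u,v)$ for $t\ge1$. $t_{\mathrm{hit}}(P)=\max_{u,w\in V}\mathbf{E}[\min\{t\ge 0:Y_t=w\}\mid Y_0=u]$ for the time-homogeneous chain $(Y_t)$ with transition matrix $P$; $t_{\mathrm{HIT}}(\mathcal{P})=\max_{t\ge 1}t_{\mathrm{hit}}(P_t)$ (read as a supremum, assumed finite). *)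

(* Defs.v *)
From HB Require Import structures.
From mathcomp Require Import all_boot all_order all_algebra.
From mathcomp Require Import all_classical all_reals all_analysis.
Import Order.TTheory GRing.Theory Num.Theory.
Import numFieldNormedType.Exports.

Set Implicit Arguments.
Unset Strict Implicit.
Unset Printing Implicit Defensive.

Local Open Scope classical_set_scope.
Local Open Scope ring_scope.

Section TransitionMatrices.
Context {R : realType} {V : finType}.
Implicit Types (P : V -> V -> R) (pi : V -> R).

Definition transition_matrix P : Prop :=
  (forall u v, 0 <= P u v <= 1) /\ (forall u, \sum_v P u v = 1).

(* The matrix power [P^t (u, v)]; indices range over an arbitrary finite type,
   so the ring of ['I_n]-indexed square matrices is not directly available. *)
Fixpoint mpow P (t : nat) (u v : V) : R :=
  if t is s.+1 then \sum_w P u w * mpow P s w v else (u == v)%:R.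

Definition irreducible P : Prop :=
  forall u v, exists2 t : nat, (0 < t)%N & 0 < mpow P t u v.

Definition lazy P : Prop := forall v, 2^-1 <= P v v.

Definition stationary pi P : Prop :=
  [/\ forall v, 0 <= pi v, \sum_v pi v = 1 &
      forall v, \sum_u pi u * P u v = pi v].

Definition reversible pi P : Prop :=
  forall u v, pi u * P u v = pi v * P v u.

End TransitionMatrices.

Section Chains.
Context {R : realType} {V : finType}.

Definition cond_prob d (Omega : measurableType d) (Pr : probability Omega R)
    (A B : set Omega) : R :=
  fine (Pr (A `&` B)) / fine (Pr B).

(* [Q t] governs the step from time [t.-1] to time [t] for [t >= 1]; [Q 0] is
   not used.  Conditioning is on the whole history [X_0 = x_0, ..., X_t = x_t],
   whenever that history has positive probability.  [V] carries the discrete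
   sigma-algebra, so a map into it is measurable iff its fibres are. *)
Definition markov_chain d (Omega : measurableType d)
    (Pr : probability Omega R) (Q : nat -> V -> V -> R)
    (X : nat -> Omega -> V) : Prop :=
  (forall t v, measurable [set o | X t o = v]) /\
  (forall (t : nat) (x : nat -> V) (v : V),
     let history := [set o | forall s : nat, (s <= t)%N -> X s o = x s] in
     (0 < Pr history)%E ->
     cond_prob Pr [set o | X t.+1 o = v] history = Q t.+1 (x t) v).

(* [min {t >= 0 : Y_t = w}], equal to [+oo] when [w] is never visited *)
Definition hitting_time (Omega : Type) (Y : nat -> Omega -> V) (w : V)
    (o : Omega) : \bar R :=
  ereal_inf [set t%:R%:E | t in [set t : nat | Y t o = w]].

(* [E[min {t >= 0 : Y_t = w} | Y_0 = u]] for a time-homogeneous chain [Y] with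
   transition matrix [P].  The expectation depends only on the law of [Y], so
   for a transition matrix [P] the set below, which collects its values over
   all realisations of the chain started at [u], is a singleton; [ereal_sup]
   extracts its element. *)
Definition expected_hitting_time (P : V -> V -> R) (u w : V) : \bar R :=
  ereal_sup [set e : \bar R |
    exists (d : measure_display) (Omega : measurableType d)
           (Pr : probability Omega R) (Y : nat -> Omega -> V),
      [/\ markov_chain Pr (fun=> P) Y,
          Pr [set o | Y 0%N o = u] = 1%E &
          e = (\int[Pr]_(o in setT) hitting_time Y w o)%E]].

Definition t_hit (P : V -> V -> R) : \bar R :=
  ereal_sup [set expected_hitting_time P uw.1 uw.2 | uw in [set: V * V]].

Definition t_HIT (P : nat -> V -> V -> R) : \bar R :=
  ereal_sup [set t_hit (P t) | t in [set t : nat | (1 <= t)%N]].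

End Chains.

(* Main.v *)
(* Write <f, g> for the inner product weighted by pi and D_w for the projection
   killing the coordinate w.  By reversibility the survival probability is
   <1, D_{w_T} P_T D_{w_{T-1}} ... P_1 D_{w_0} 1>, so it suffices that
   D_{w'} P_t D_w has norm at most beta = 1 - 1 / t_hit(P_t).  Laziness makes
   P_t positive semidefinite, and Cauchy-Schwarz for the form <f, P_t g> reduces
   this to <f, P_t f> <= beta <f, f> whenever f w = 0.  Here
   phi u = E_u[tau_w] satisfies P_t phi = phi - 1 <= beta phi off w, and a
   positive supersolution bounds the form by AM-GM on each edge.
   As t_hit is a supremum over realisations of the chain, bounding it from below
   by phi needs an actual realisation: one is built on [0, 1[ with Lebesgue
   measure, cylinder events being nested subintervals. *)

Require Import Defs.
From HB Require Import structures.
From mathcomp Require Import all_boot all_order all_algebra.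
From mathcomp Require Import all_classical all_reals all_analysis.
From mathcomp Require Import measurable_realfun ring lra.
Import Order.TTheory GRing.Theory Num.Theory.
Import numFieldNormedType.Exports.
Local Open Scope classical_set_scope.
Local Open Scope ring_scope.

Set Implicit Arguments.
Unset Strict Implicit.
Unset Printing Implicit Defensive.

(** * The law of a Markov chain killed at a moving target *)

Lemma measure_fibers (R : realType) d (T : measurableType d)
    (mu : {measure set T -> \bar R}) (I : finType) (g : T -> I) (A : set T) :
  measurable A -> (forall i, measurable [set x | g x = i]) ->
  mu A = (\sum_(i : I) mu (A `&` [set x | g x = i]))%E.
Proof.
move=> mA mg.
have AE : A = \bigcup_(i in [set: I]) (A `&` [set x | g x = i]).
  by apply/seteqP; split => [x Ax|x [i _ []//]]; exists (g x).
rewrite {1}AE measure_fin_bigcup; last 3 first.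
- exact: finite_finset.
- by move=> i j _ _ [x [[_ <-] [_ <-]]].
- by move=> i _; exact: measurableI.
rewrite (@fsbigE _ _ _ _ _ (index_enum I)) ?index_enum_uniq//; last first.
  by move=> i _; rewrite mem_index_enum.
by apply: eq_bigl => i; rewrite in_setT.
Qed.

Section MarkovChain.
Context {R : realType} {V : finType} {d : measure_display}.
Context {Omega : measurableType d}.
Variables (Pr : probability Omega R) (Q : nat -> V -> V -> R).
Variable X : nat -> Omega -> V.
Hypothesis hX : markov_chain Pr Q X.

Let measurable_state t v : measurable [set o | X t o = v].
Proof. by case: hX. Qed.

Lemma measurable_history t (x : nat -> V) :
  measurable [set o | forall s : nat, (s <= t)%N -> X s o = x s].
Proof.
rewrite [X in measurable X](_ : _ =
    \bigcap_(s in [set s | (s <= t)%N]) [set o | X s o = x s]) //.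
by apply: bigcap_measurableType => s _; exact: measurable_state.
Qed.

(** The Markov property is available only for full histories. An event determined by the states up
    to [t] is a finite disjoint union of such histories, and those of probability zero contribute
    nothing to either side. *)
Lemma markov_step t (E : set Omega) u v : measurable E ->
  (forall o o2, (forall s : nat, (s <= t)%N -> X s o = X s o2) ->
    E o -> E o2) ->
  E `<=` [set o | X t o = u] ->
  fine (Pr (E `&` [set o | X t.+1 o = v])) = Q t.+1 u v * fine (Pr E).
Proof.
move=> mE detE Eu.
pose g o := [ffun i : 'I_t.+1 => X i o].
pose h (x : {ffun 'I_t.+1 -> V}) (s : nat) := x (inord s).
have gE x : [set o | g o = x] =
    [set o | forall s : nat, (s <= t)%N -> X s o = h x s].
  apply/seteqP; split => [ o /= gx s st|o /= gx].
    by rewrite -gx /h /g ffunE inordK.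
  apply/ffunP => i; rewrite ffunE gx -1?ltnS ?ltn_ord//.
  by rewrite /h inord_val.
have mg x : measurable [set o | g o = x].
  by rewrite gE; exact: measurable_history.
have fin_sum (A : set Omega) : measurable A ->
    fine (Pr A) = \sum_x fine (Pr (A `&` [set o | g o = x])).
  move=> mA; rewrite (measure_fibers Pr mA mg) -sum_fine// => x _.
  by apply: fin_num_measure; exact: measurableI.
have mEv : measurable (E `&` [set o | X t.+1 o = v]) by exact: measurableI.
rewrite (fin_sum _ mEv) (fin_sum _ mE) mulr_sumr; apply: eq_bigr => x _.
rewrite setIAC.
have [->|/set0P[ o [Eo gox]]] := eqVneq (E `&` [set o | g o = x]) set0.
  by rewrite set0I measure0 mulr0.
have xu : h x t = u.
  have /(_ t (leqnn t)) : forall s : nat, (s <= t)%N -> X s o = h x s.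
    by move: gox; rewrite -/([set o | g o = x] o) gE.
  by move=> <-; apply: Eu.
have -> : E `&` [set o | g o = x] = [set o | g o = x].
  apply/setIidPr => o2 go2; apply: detE Eo => s st.
  move: gox go2; rewrite /= => <- /ffunP/(_ (inord s)).
  by rewrite !ffunE inordK.
have [F0|Fgt0] := leP (fine (Pr [set o | g o = x])) 0.
  have Pr0 : Pr [set o | g o = x] = 0%E.
    apply/eqP; rewrite -(fineK (fin_num_measure Pr _ (mg x))) eqe eq_le F0.
    by rewrite fine_ge0.
  rewrite Pr0 mulr0 (@subset_measure0 _ _ _ Pr _ [set o | g o = x])//.
  exact: measurableI.
have Pgt0 : (0 < Pr [set o | g o = x])%E.
  by rewrite -(fineK (fin_num_measure Pr _ (mg x))) lte_fin.
have [_ /(_ t (h x) v)] := hX.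
rewrite /= -gE xu => /(_ Pgt0) <-.
by rewrite /cond_prob setIC mulfVK// gt_eqF.
Qed.

Variable w : nat -> V.

Definition avoids t : set Omega :=
  [set o | forall s : nat, (s <= t)%N -> X s o <> w s].

Definition avoid_mass t v : R :=
  fine (Pr (avoids t `&` [set o | X t o = v])).

Lemma measurable_avoids t : measurable (avoids t).
Proof.
rewrite /avoids [X in measurable X](_ : _ =
    \bigcap_(s in [set s | (s <= t)%N]) ~` [set o | X s o = w s]) //.
by apply: bigcap_measurableType => s _; apply: measurableC.
Qed.

Lemma prob_avoids t : fine (Pr (avoids t)) = \sum_v avoid_mass t v.
Proof.
rewrite (measure_fibers Pr (measurable_avoids t) (measurable_state t)).
rewrite -sum_fine// => v _; apply: fin_num_measure.
by apply: measurableI => //; exact: measurable_avoids.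
Qed.

Lemma avoid_mass0 v :
  avoid_mass 0 v = (v != w 0%N)%:R * fine (Pr [set o | X 0%N o = v]).
Proof.
rewrite /avoid_mass; case: eqVneq => [->|vw] /=.
  rewrite mul0r [X in Pr X](_ : _ = set0) ?measure0//.
  by apply/seteqP; split => // o [/(_ 0%N (leqnn _)) /= h /h].
rewrite mul1r; congr (fine (Pr _)); apply/setIidPr => o /= ov s.
by rewrite leqn0 => /eqP ->; rewrite ov; exact/eqP.
Qed.

Lemma avoid_massS t v :
  avoid_mass t.+1 v = (v != w t.+1)%:R * \sum_u avoid_mass t u * Q t.+1 u v.
Proof.
rewrite /avoid_mass; case: eqVneq => [->|/eqP vw] /=.
  rewrite mul0r [X in Pr X](_ : _ = set0) ?measure0//.
  by apply/seteqP; split => // o [/(_ t.+1 (leqnn _)) /= h /h].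
rewrite mul1r.
have -> : avoids t.+1 `&` [set o | X t.+1 o = v] =
          avoids t `&` [set o | X t.+1 o = v].
  apply/seteqP; split => o [av /= ov]; split => //= s st.
    by apply: av; exact: leqW.
  by move: st; rewrite leq_eqVlt => /predU1P[->|/av//]; rewrite ov.
have mav := measurable_avoids t.
have mA : measurable (avoids t `&` [set o | X t.+1 o = v]) by exact: measurableI.
rewrite (measure_fibers Pr mA (measurable_state t)) -sum_fine; last first.
  by move=> u _; apply: fin_num_measure; exact: measurableI.
apply: eq_bigr => u _; rewrite setIAC (@markov_step t _ u).
- by rewrite mulrC.
- exact: measurableI.
- move=> o o2 eqX [av /= <-]; split => /=; last by rewrite eqX.
  by move=> s st; rewrite -eqX//; exact: av.
- by move=> o [].
Qed.

End MarkovChain.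

(** * Quadratic forms of a lazy reversible kernel *)

Section ReversibleForm.
Context {R : realType} {V : finType}.
Variables (pi : V -> R) (P : V -> V -> R).
Hypothesis pi_ge0 : forall u, 0 <= pi u.
Hypothesis tP : transition_matrix P.
Hypothesis revP : reversible pi P.
Implicit Types (f g phi : V -> R) (beta c : R) (w : V).

(** This is [<f, P g>], written as a sum over edges so that inequalities can be checked edge by
    edge. *)
Definition transition_form f g : R := \sum_u \sum_v pi u * P u v * (f u * g v).

Definition l2norm2 f : R := \sum_u pi u * f u ^+ 2.

Let P_ge0 u v : 0 <= P u v.
Proof. by have [/(_ u v)/andP[]] := tP. Qed.

Lemma transition_formC f g : transition_form f g = transition_form g f.
Proof.
rewrite /transition_form exchange_big; apply: eq_bigr => u _.
by apply: eq_bigr => v _; rewrite revP [f v * _]mulrC.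
Qed.

Lemma transition_form_sub f g c :
  transition_form (fun u => f u - c * g u) (fun u => f u - c * g u) =
  transition_form f f - 2 * c * transition_form f g + c ^+ 2 * transition_form g g.
Proof.
have -> : 2 * c * transition_form f g =
    c * transition_form f g + c * transition_form g f.
  by rewrite (transition_formC g f); ring.
rewrite /transition_form !mulr_sumr -big_split -sumrB -big_split.
apply: eq_bigr => u _; rewrite /= !mulr_sumr -big_split -sumrB -big_split.
by apply: eq_bigr => v _ /=; ring.
Qed.

Lemma sum_edges_l f :
  \sum_u \sum_v pi u * P u v * f u ^+ 2 = l2norm2 f.
Proof.
apply: eq_bigr => u _; rewrite -mulr_suml -mulr_sumr.
by have [_ ->] := tP; rewrite mulr1.
Qed.

Lemma sum_edges_r f :
  \sum_u \sum_v pi u * P u v * f v ^+ 2 = l2norm2 f.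
Proof.
rewrite exchange_big -sum_edges_l; apply: eq_bigr => u _.
by apply: eq_bigr => v _; rewrite revP.
Qed.

(** The edge sum of [(f u + f v) ^+ 2] equals [2 <f, f> + 2 <f, P f>], and by laziness its diagonal
    terms alone reach [2 <f, f>]. *)
Lemma lazy_transition_form_ge0 f : lazy P -> 0 <= transition_form f f.
Proof.
move=> lazyP.
have sqE : \sum_u \sum_v pi u * P u v * (f u + f v) ^+ 2 =
    2 * l2norm2 f + 2 * transition_form f f.
  have -> : 2 * l2norm2 f = l2norm2 f + l2norm2 f by ring.
  rewrite -{1}sum_edges_l -sum_edges_r /transition_form mulr_sumr -!big_split.
  apply: eq_bigr => u _; rewrite /= mulr_sumr -!big_split.
  by apply: eq_bigr => v _ /=; ring.
have : 2 * l2norm2 f <= \sum_u \sum_v pi u * P u v * (f u + f v) ^+ 2.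
  rewrite mulr_sumr; apply: ler_sum => u _; rewrite (bigD1 u)//=.
  apply: ler_wpDr.
    by apply: sumr_ge0 => v _; apply: mulr_ge0; [exact: mulr_ge0|exact: sqr_ge0].
  have -> : pi u * P u u * (f u + f u) ^+ 2 =
      (4 * P u u) * (pi u * f u ^+ 2) by ring.
  apply: ler_wpM2r; first by rewrite mulr_ge0// sqr_ge0.
  by have := lazyP u; lra.
by rewrite sqE; lra.
Qed.

(** A Collatz-Wielandt type bound for the kernel killed at [w], with [phi] as test function. *)
Lemma supersolution_bound phi beta w f :
  (forall u, 0 <= phi u) -> (forall u, u != w -> 0 < phi u) ->
  (forall u, u != w -> \sum_v P u v * phi v <= beta * phi u) ->
  f w = 0 -> transition_form f f <= beta * l2norm2 f.
Proof.
move=> phi_ge0 phi_gt0 Pphi fw.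
(* AM-GM: [2 f u f v <= f u ^+ 2 * phi v / phi u + f v ^+ 2 * phi u / phi v],
   and both terms have the same sum [S] by reversibility. *)
pose S := \sum_u \sum_v pi u * P u v * (f u ^+ 2 * (phi v / phi u)).
have SE : S = \sum_u \sum_v pi u * P u v * (f v ^+ 2 * (phi u / phi v)).
  rewrite /S exchange_big; apply: eq_bigr => u _.
  by apply: eq_bigr => v _; rewrite revP.
have form_le : 2 * transition_form f f <= S + S.
  rewrite {2}SE /S /transition_form mulr_sumr -big_split; apply: ler_sum => u _.
  rewrite mulr_sumr -big_split; apply: ler_sum => v _ /=.
  rewrite mulrCA -mulrDr; apply: ler_wpM2l; first by rewrite mulr_ge0.
  have sq_ge0 a b : 0 <= a ^+ 2 * (phi b / phi b) by
    rewrite mulr_ge0 ?sqr_ge0// divr_ge0.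
  (* On edges at [w] the left side is zero. There [phi w] may vanish, but then its inverse is 0 and
     the right side stays nonnegative. *)
  have [->|uw] := eqVneq u w.
    by rewrite fw mul0r mulr0 addr_ge0// mulr_ge0 ?sqr_ge0// divr_ge0.
  have [->|vw] := eqVneq v w.
    by rewrite fw !mulr0 addr_ge0// mulr_ge0 ?sqr_ge0// divr_ge0.
  have pu := phi_gt0 _ uw; have pv := phi_gt0 _ vw.
  rewrite -subr_ge0.
  have -> : f u ^+ 2 * (phi v / phi u) + f v ^+ 2 * (phi u / phi v) -
      2 * (f u * f v) =
      (f u * phi v - f v * phi u) ^+ 2 / (phi u * phi v).
    by field; rewrite !gt_eqF.
  by rewrite divr_ge0 ?sqr_ge0// mulr_ge0.
suff : S <= beta * l2norm2 f by lra.
rewrite mulr_sumr; apply: ler_sum => u _.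
have [->|uw] := eqVneq u w.
  rewrite fw expr0n /= !mulr0 big1// => v _.
  by rewrite mul0r mulr0.
rewrite (_ : \sum_v _ = pi u * f u ^+ 2 * ((\sum_v P u v * phi v) / phi u)).
  rewrite [leRHS]mulrC; apply: ler_wpM2l; first by rewrite mulr_ge0 ?sqr_ge0.
  by rewrite ler_pdivrMr ?phi_gt0// Pphi.
by rewrite mulr_suml mulr_sumr; apply: eq_bigr => v _; ring.
Qed.

(** Cauchy-Schwarz in one test vector: semidefiniteness at [g - beta f], together with
    [<g, P f> = <g, g>], gives [0 <= beta <g, g> - 2 beta <g, g> + beta ^+ 3 <f, f>]. *)
Lemma killed_step_contraction w beta f g : 0 < beta -> lazy P ->
  (forall u, g u = (u != w)%:R * \sum_v P u v * f v) ->
  transition_form f f <= beta * l2norm2 f ->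
  transition_form g g <= beta * l2norm2 g ->
  l2norm2 g <= beta ^+ 2 * l2norm2 f.
Proof.
move=> beta_gt0 lazyP gE ff gg.
(* [g] vanishes where the walk is killed, so [g * g = g * P f] pointwise. *)
have ng : l2norm2 g = transition_form g f.
  apply: eq_bigr => u _; rewrite expr2 {2}gE.
  rewrite (_ : g u * _ = g u * \sum_v P u v * f v); last first.
    by rewrite gE; case: (u == w); rewrite ?mul0r ?mul1r.
  by rewrite !mulr_sumr; apply: eq_bigr => v _; ring.
have := lazy_transition_form_ge0 (fun u => g u - beta * f u) lazyP.
rewrite transition_form_sub -ng => h.
have {}h : 0 <= beta * (beta ^+ 2 * l2norm2 f - l2norm2 g).
  apply: le_trans h _.
  have := ler_wpM2l (sqr_ge0 beta) ff.
  lra.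
by rewrite -subr_ge0 -(pmulr_rge0 _ beta_gt0).
Qed.

End ReversibleForm.

(** * Survival functions and the hitting-time equation *)

(** Time runs backwards: from [v] at time [t] the kernels [Q t], ..., [Q 1] are applied in this
    order. For constant [Q] and [w] it is the probability that a chain started at [v] has not hit
    [w] by time [t]. *)
Fixpoint survival {R : realType} {V : finType} (Q : nat -> V -> V -> R)
    (w : nat -> V) (t : nat) (v : V) : R :=
  if t is s.+1 then (v != w t)%:R * \sum_u Q t v u * survival Q w s u
  else (v != w 0%N)%:R.

Section Survival.
Context {R : realType} {V : finType}.
Variables (P : V -> V -> R) (w : V).
Hypothesis tP : transition_matrix P.

Local Notation q := (survival (fun=> P) (fun=> w)).

Lemma survival_target k : q k w = 0.
Proof. by case: k => [|k] /=; rewrite eqxx ?mul0r. Qed.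

Lemma survival_offtarget k v : (v != w)%:R * q k v = q k v.
Proof. by case: eqVneq => [->|_]; rewrite ?survival_target ?mulr0 ?mul1r. Qed.

Lemma survival_ge0 k v : 0 <= q k v.
Proof.
elim: k v => [|k IHk] v /=; first exact: ler0n.
rewrite mulr_ge0 ?ler0n//; apply: sumr_ge0 => u _; rewrite mulr_ge0//.
by have [/(_ v u)/andP[]] := tP.
Qed.

(** The witness is [E[tau] = sum_k Pr[tau > k]]. Its partial sums increase and are bounded by [H],
    so first-step analysis passes to the limit. *)
Lemma expected_hitting_time_equation (H : R) :
  (forall n u, \sum_(0 <= k < n) q k u <= H) ->
  exists phi : V -> R, [/\ forall u, 0 <= phi u <= H, phi w = 0 &
    forall u, u != w -> phi u = 1 + \sum_v P u v * phi v].
Proof.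
move=> qH.
pose S u : R^nat := fun n => \sum_(0 <= k < n) q k u.
have S_nd u : nondecreasing_seq (S u).
  apply/nondecreasing_seqP => n; rewrite /S big_nat_recr//= lerDl.
  exact: survival_ge0.
have S_cvg u : cvgn (S u).
  by apply: nondecreasing_is_cvgn => //; exists H => _ [n _ <-]; exact: qH.
exists (fun u => limn (S u)); split.
- move=> u; apply/andP; split.
    by have := nondecreasing_cvgn_le (S_nd u) (S_cvg u) 0%N; rewrite /S big_geq.
  by apply: limr_le => //; apply: nearW => n; exact: qH.
- rewrite (_ : S w = fun=> 0) ?lim_cst//; apply/funext => n.
  by rewrite /S big1// => k _; exact: survival_target.
- move=> u uw.
  have SS n : S u n.+1 = 1 + \sum_v P u v * S v n.
    rewrite /S big_nat_recl//= uw; congr (_ + _).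
    under eq_bigr do rewrite mul1r.
    by rewrite exchange_big; apply: eq_bigr => v _; rewrite mulr_sumr.
  have lim1 : (fun n => S u n.+1) @ \oo --> limn (S u).
    by have := S_cvg u; rewrite -cvg_shiftS.
  have lim2 : (fun n => S u n.+1) @ \oo --> 1 + \sum_v P u v * limn (S v).
    rewrite (_ : (fun n => S u n.+1) = fun n => 1 + \sum_v P u v * S v n).
      apply: cvgD; first exact: cvg_cst.
      apply: cvg_big => [|v _]; first exact: add_continuous.
      by apply: cvgMl_tmp; exact: S_cvg.
    by apply/funext.
  exact: (cvg_unique _ lim1 lim2).
Qed.

End Survival.

(** * Expected hitting time of an arbitrary realisation *)

Section IntegralMonotone.
Local Open Scope ereal_scope.

(* Unlike [ge0_le_integral], this needs no measurability: the integral of a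
   nonnegative function is a supremum over simple functions below it. *)
Lemma nonneg_le_integral (R : realType) d (T : measurableType d)
    (mu : {measure set T -> \bar R}) (f g : T -> \bar R) :
  (forall x, 0 <= f x) -> (forall x, f x <= g x) ->
  \int[mu]_(x in setT) f x <= \int[mu]_(x in setT) g x.
Proof.
move=> f0 fg.
have g0 x : 0 <= g x by exact: le_trans (f0 x) (fg x).
rewrite !ge0_integralTE//; apply: ereal_sup_le => _ [h hf <-].
by exists h => // x; exact: le_trans (hf x) (fg x).
Qed.

End IntegralMonotone.

Section HittingTime.
Context {R : realType} {V : finType} {d : measure_display}.
Context {Omega : measurableType d}.
Variables (Pr : probability Omega R) (P : V -> V -> R).
Variable Y : nat -> Omega -> V.
Hypothesis hY : markov_chain Pr (fun=> P) Y.
Variables (u w : V).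
Hypothesis hY0 : Pr [set o | Y 0%N o = u] = 1%E.

Local Notation q := (survival (fun=> P) (fun=> w)).
Local Notation a := (avoid_mass Pr Y (fun=> w)).

Let measurable_state t v : measurable [set o | Y t o = v].
Proof. by case: hY. Qed.

Let start_law v : fine (Pr [set o | Y 0%N o = v]) = (v == u)%:R.
Proof.
have [->|vu] := eqVneq v u; first by rewrite hY0.
rewrite (@subset_measure0 _ _ _ Pr _ (~` [set o | Y 0%N o = u]))//.
- exact: measurableC.
- by move=> o /= ->; exact/eqP.
- rewrite [LHS]probability_setC//.
  by rewrite hY0 subee.
Qed.

Let mass_offtarget k v : (v != w)%:R * a k v = a k v.
Proof.
by case: k => [|k]; rewrite ?avoid_mass0 ?(avoid_massS hY);
  case: eqVneq; rewrite /= ?(mul0r, mul1r).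
Qed.

(** Chapman-Kolmogorov for the killed chain: the induction hands steps one at a time from the
    forward mass to the survival function. Both factors kill at the intermediate time, which is
    harmless because killing is idempotent. *)
Lemma sum_mass_survival k j : \sum_v a k v * q j v = q (k + j) u.
Proof.
elim: k j => [|k IHk] j.
  rewrite (bigD1 u)//= big1 => [|v vu].
    rewrite avoid_mass0 start_law eqxx mulr1 addr0.
    exact: survival_offtarget.
  by rewrite avoid_mass0 start_law (negbTE vu) mulr0 mul0r.
rewrite addSnnS -IHk.
under eq_bigr => v _.
  rewrite (avoid_massS hY) mulrAC survival_offtarget mulr_sumr.
  over.
rewrite exchange_big; apply: eq_bigr => x _ /=.
transitivity (a k x * \sum_v P x v * q j v).
  by rewrite mulr_sumr; apply: eq_bigr => v _; ring.
by rewrite -{1}(mass_offtarget k x); ring.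
Qed.

Lemma prob_avoids_target k :
  Pr (avoids Y (fun=> w) k) = (q k u)%:E.
Proof.
rewrite -[LHS]fineK; last first.
  by apply: fin_num_measure; exact: (measurable_avoids hY).
congr (_%:E); rewrite (prob_avoids hY) -[k in RHS]addn0 -sum_mass_survival.
by apply: eq_bigr => v _ /=; rewrite mulrC mass_offtarget.
Qed.

(** The left side counts the times [k < n] before the first visit, so it is at most [minn n t] for
    every visiting time [t]. *)
Lemma hitting_time_ge_sum n o :
  (\sum_(0 <= k < n) (\1_(avoids Y (fun=> w) k) o)%:E <=
   hitting_time Y w o :> \bar R)%E.
Proof.
apply: le_ereal_inf_tmp => _ [t Yt <-].
rewrite sumEFin lee_fin.
apply: (@le_trans _ _ (\sum_(0 <= k < n) (k < t)%:R)).
  apply: ler_sum => k _; rewrite indicE ler_nat.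
  case: ltnP => [_|tk]; first exact: leq_b1.
  by rewrite memNset// => /(_ t tk).
rewrite -natr_sum ler_nat.
suff -> : (\sum_(0 <= k < n) (k < t) = minn n t)%N by exact: geq_minr.
elim: n => [|n IHn]; first by rewrite big_geq// min0n.
rewrite big_nat_recr//= IHn; case: ltnP => nt.
  by rewrite (minn_idPl nt) addn1.
by rewrite (minn_idPr (leqW nt)) addn0.
Qed.

Lemma expectation_hitting_time_ge n :
  ((\sum_(0 <= k < n) q k u)%:E <= \int[Pr]_(o in setT) hitting_time Y w o)%E.
Proof.
have mA k : measurable (avoids Y (fun=> w) k).
  exact: (measurable_avoids hY).
apply: le_trans; last first.
  apply: nonneg_le_integral (hitting_time_ge_sum n).
  by move=> o; apply: sume_ge0 => k _; rewrite lee_fin.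
rewrite ge0_integral_sum//; last by move=> k; apply/measurable_EFinP.
rewrite -sumEFin. apply: lee_sum => k _.
by rewrite integral_indic// setIT -prob_avoids_target.
Qed.

End HittingTime.

(** * A realisation of the chain on the unit interval *)

Section UnitInterval.
Context (R : realType).

Definition unit_prob : set (measurableTypeR R) -> \bar R :=
  mrestr lebesgue_measure (measurable_itv `[(0 : R), 1[).

HB.instance Definition _ := Measure.copy unit_prob
  (mrestr (@lebesgue_measure R) (measurable_itv `[(0 : R), 1[)).

Let unit_prob_setT : unit_prob setT = 1%E.
Proof.
by rewrite /unit_prob /mrestr setTI lebesgue_measure_itv/= lte01 oppr0 adde0.
Qed.

HB.instance Definition _ :=
  Measure_isProbability.Build _ _ R unit_prob unit_prob_setT.

End UnitInterval.

Arguments unit_prob : clear implicits.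

Section IntervalRealisation.
Context {R : realType} {V : finType}.
Variable P : V -> V -> R.
Hypothesis tP : transition_matrix P.

Let P_ge0 u v : 0 <= P u v.
Proof. by have [/(_ u v)/andP[]] := tP. Qed.

(** The default of [nth] enters only beyond [#|V|]; at [#|V|] the value is already 1. *)
Definition row_cdf u k : R := \sum_(0 <= i < k) P u (nth u (enum V) i).

(* The [v]-th of the consecutive intervals of lengths [P u v], [v] in [V],
   into which [0, 1[ is cut. *)
Definition row_bin u v (x : R) : bool :=
  row_cdf u (index v (enum V)) <= x < row_cdf u (index v (enum V)).+1.

Definition next_state u x : V := odflt u [pick v | row_bin u v x].

(* Zooming into the interval just visited turns a uniform [x] into a uniform
   variable again, which drives the next step. *)
Fixpoint interval_path u (x : R) (t : nat) : V :=
  if t is s.+1 then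
    let v := next_state u x in
    interval_path v ((x - row_cdf u (index v (enum V))) / P u v) s
  else u.

Let index_lt (v : V) : (index v (enum V) < #|V|)%N.
Proof. by rewrite cardE index_mem mem_enum. Qed.

Lemma row_cdf_nondecreasing u : {homo row_cdf u : i j / (i <= j)%N >-> i <= j}.
Proof.
apply: homo_leq => [x|y x z|k]; [exact: lexx|exact: le_trans|].
by rewrite /row_cdf big_nat_recr//= lerDl.
Qed.

Lemma row_cdf_index u v : row_cdf u (index v (enum V)).+1 =
  row_cdf u (index v (enum V)) + P u v.
Proof. by rewrite /row_cdf big_nat_recr//= nth_index ?mem_enum. Qed.

Lemma row_cdf0 u : row_cdf u 0 = 0.
Proof. by rewrite /row_cdf big_geq. Qed.

Lemma row_cdf_card u : row_cdf u #|V| = 1.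
Proof.
have [_ /(_ u) <-] := tP.
by rewrite /row_cdf cardE -[RHS]big_enum (big_nth u).
Qed.

(** The bins of a row partition [[0, 1[], so the choice made by [pick] is forced and its default is
    never reached. *)
Lemma row_binP u v x : 0 <= x < 1 -> (next_state u x == v) = row_bin u v x.
Proof.
move=> /andP[x0 x1].
have uniq_bin v1 v2 : row_bin u v1 x -> row_bin u v2 x -> v1 = v2.
  have lt_bin a b : (index a (enum V) < index b (enum V))%N ->
      row_bin u a x -> row_bin u b x -> False.
    move=> /(row_cdf_nondecreasing u) ab /andP[_ xa] /andP[bx _].
    by have := lt_le_trans (lt_le_trans xa ab) bx; rewrite ltxx.
  move=> b1 b2; have m1 : v1 \in enum V by rewrite mem_enum.
  have m2 : v2 \in enum V by rewrite mem_enum.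
  rewrite -(nth_index v1 m1) -[v2](nth_index v1 m2); congr nth.
  by case: (ltngtP (index v1 (enum V)) (index v2 (enum V))) => // h;
    [case: (lt_bin _ _ h b1 b2)|case: (lt_bin _ _ h b2 b1)].
have [v0 bin0] : exists v0, row_bin u v0 x.
  (* The least such [k] marks the right end of the bin of [x]; it is positive since
     [row_cdf u 0 = 0]. *)
  have exk : exists k, x < row_cdf u k by exists #|V|; rewrite row_cdf_card.
  case: (ex_minnP exk) => -[|k] xk kmin.
    by move: xk; rewrite row_cdf0 ltNge x0.
  have kV : (k < #|V|)%N by apply: kmin; rewrite row_cdf_card.
  exists (nth u (enum V) k).
  rewrite /row_bin index_uniq ?enum_uniq -?cardE// xk andbT leNgt.
  by apply/negP => /kmin; rewrite ltnn.
rewrite /next_state; case: pickP => [v1 b1|/(_ v0)]; last by rewrite bin0.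
apply/eqP/idP => /= [<- //|]; exact: uniq_bin.
Qed.

(** The first step zooms affinely into a bin of length [P (x 0) (x 1)], so the preimage of a
    cylinder interval is again an interval, shrunk by that factor. *)
Lemma interval_path_cylinder t (x : nat -> V) : exists a b : R,
  [/\ 0 <= a, a <= b, b <= 1, b - a = \prod_(0 <= s < t) P (x s) (x s.+1) &
    forall y, (0 <= y < 1 /\
      forall s : nat, (s <= t)%N -> interval_path (x 0%N) y s = x s) <->
      a <= y < b].
Proof.
elim: t x => [|t IHt] x.
  exists 0, 1; split; rewrite ?ler01// ?big_geq ?subr0// => y.
  by split => [[]//|y01]; split => // s; rewrite leqn0 => /eqP ->.
have [a [b [a0 ab b1 lab cyl]]] := IHt (fun s => x s.+1).
set u := x 0%N; set v := x 1%N in cyl *.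
set p := P u v; set F := row_cdf u (index v (enum V)).
have F0 : 0 <= F by rewrite -(row_cdf0 u); exact: row_cdf_nondecreasing.
have F1 : F + p <= 1.
  rewrite -row_cdf_index -(row_cdf_card u).
  by apply: row_cdf_nondecreasing; exact: index_lt.
have p0 : 0 <= p := P_ge0 u v.
have pa0 : 0 <= p * a by exact: mulr_ge0.
have pab : p * a <= p * b by exact: ler_wpM2l.
have pb1 : p * b <= p by rewrite ler_piMr.
(* Preimage of [[a, b[] under the zoom [y |-> (y - F) / p]; it is empty when [p = 0], which is why
   both directions below first derive [0 < p]. *)
exists (F + p * a), (F + p * b); split.
- lra.
- lra.
- lra.
- rewrite big_nat_recl//= -lab -/u -/v -/p; ring.
move=> y; pose z := (y - F) / p.
have binE : row_bin u v y = (F <= y < F + p) by rewrite /row_bin row_cdf_index.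
have zE : 0 < p -> (a <= z < b) = (F + p * a <= y < F + p * b).
  move=> pgt0; rewrite /z ler_pdivlMr// ltr_pdivrMr//.
  by rewrite lerBrDl ltrBlDl ![_ * p]mulrC.
have z01 : 0 < p -> (0 <= z < 1) = (F <= y < F + p).
  move=> pgt0; rewrite /z ler_pdivlMr// ltr_pdivrMr//.
  by rewrite lerBrDl ltrBlDl mul0r addr0 mul1r.
split => [[y01 path]|ycyl].
  have nxt : next_state u y = v by exact: (path 1%N).
  have Fy : F <= y < F + p by rewrite -binE -row_binP// nxt.
  have pgt0 : 0 < p by lra.
  rewrite -zE//; apply/cyl; split; first by rewrite z01.
  move=> s st; have := path s.+1 st.
  by rewrite /= nxt.
have pgt0 : 0 < p.
  rewrite lt_neqAle p0 andbT eq_sym; apply/negP => /eqP pE.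
  by move: ycyl; rewrite pE !mul0r; lra.
have /cyl[zz path] : a <= z < b by rewrite zE.
have Fy : F <= y < F + p by rewrite -z01.
have y01 : 0 <= y < 1 by lra.
have nxt : next_state u y = v by apply/eqP; rewrite row_binP// binE.
split=> // -[_ //|s st].
by rewrite /= nxt; exact: path.
Qed.

Variable u : V.

(** Outside [[0, 1[], a null set for [unit_prob], the chain rests at [u], so it starts at [u]
    everywhere. *)
Definition interval_chain (t : nat) (x : measurableTypeR R) : V :=
  if 0 <= x < 1 then interval_path u x t else u.

Let history t (x : nat -> V) : set (measurableTypeR R) :=
  [set o | forall s : nat, (s <= t)%N -> interval_chain s o = x s].

Let history_cylinder t (x : nat -> V) : x 0%N = u -> exists2 a : R, 0 <= a &
  exists2 b : R, a <= b & b - a = \prod_(0 <= s < t) P (x s) (x s.+1) /\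
    history t x `&` [set` `[(0 : R), 1[] = [set` `[a, b[].
Proof.
move=> x0; have [a [b [a0 ab b1 lab cyl]]] := interval_path_cylinder t x.
exists a => //; exists b => //; split => //.
apply/seteqP; split => y /=; rewrite !in_itv/=.
  move=> [hist y01]; apply/cyl; split => // s st.
  by rewrite x0 -hist// /interval_chain y01.
move=> /cyl[y01 path]; split => // s st.
by rewrite /interval_chain y01 -x0; exact: path.
Qed.

Let history_start t (x : nat -> V) : x 0%N <> u -> history t x = set0.
Proof.
move=> x0; apply/seteqP; split => // y /= /(_ 0%N (leq0n _)).
by rewrite /interval_chain /= if_same => /esym.
Qed.

Let unit_prob_history t (x : nat -> V) : x 0%N = u ->
  unit_prob R (history t x) = (\prod_(0 <= s < t) P (x s) (x s.+1))%:E.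
Proof.
move=> /(history_cylinder t)[a a0 [b ab [lab E]]].
rewrite /unit_prob /mrestr E lebesgue_measure_itv/= lte_fin -lab.
by case: ltP => [_//|ba]; rewrite (@le_anti _ _ a b) ?subrr// ab ba.
Qed.

(** Inside [[0, 1[] the event is a finite union of cylinder intervals, over the paths from [u] to
    [v]; outside it is everything or nothing according to whether [v = u]. *)
Let measurable_chain t v : measurable [set o | interval_chain t o = v].
Proof.
pose I := [set` `[(0 : R), 1[] : set (measurableTypeR R).
have mI : measurable I by exact: measurable_itv.
rewrite -(setUIDK [set o | interval_chain t o = v] I).
apply: measurableU; last first.
  have [->|vu] := eqVneq v u.
    rewrite (_ : _ `\` _ = ~` I); first exact: measurableC.
    apply/seteqP; split => y /=; first by case.
    by rewrite /I /= in_itv/= /interval_chain; case: ifP.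
  rewrite (_ : _ `\` _ = set0)//; apply/seteqP; split => // y /= [].
  rewrite /I /= in_itv/= /interval_chain; case: ifP => // _ uv.
  by move: vu; rewrite uv eqxx.
pose h (x : {ffun 'I_t.+1 -> V}) (s : nat) := x (inord s).
rewrite (_ : _ `&` _ = \bigcup_(x in [set x : {ffun 'I_t.+1 -> V} |
    h x t = v /\ h x 0%N = u]) (history t (h x) `&` I)).
  apply: fin_bigcup_measurable => [|x [_ /(history_cylinder t)]].
    exact: finite_finset.
  by move=> [a _ [b _ [_ ->]]]; exact: measurable_itv.
apply/seteqP; split => [y [/= yv yI]|y [x [/= xt x0] [hist yI]]].
  exists [ffun i : 'I_t.+1 => interval_chain i y].
    split; first by rewrite /h ffunE inordK.
    by rewrite /h ffunE inordK// /interval_chain /= if_same.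
  by split => // s st; rewrite /h ffunE inordK.
by split => //=; rewrite -xt; exact: hist.
Qed.

(** Cylinder lengths are products along the path, so the conditional probability is a quotient of
    two consecutive products, leaving the last factor. *)
Lemma interval_chain_markov : markov_chain (unit_prob R) (fun=> P) interval_chain.
Proof.
split => // t x v /= Hgt0.
have x0 : x 0%N = u.
  apply: contrapT => /(history_start t) H0.
  by move: Hgt0; rewrite -/(history t x) H0 measure0 ltxx.
(* The path prolonged by [v]: its history up to [t.+1] is the joint event in the numerator. *)
pose x' s := if (s <= t)%N then x s else v.
have -> : cond_prob (unit_prob R) [set o | interval_chain t.+1 o = v]
    (history t x) =
  fine (unit_prob R (history t.+1 x')) / fine (unit_prob R (history t x)).
  rewrite /cond_prob; congr (fine (unit_prob R _) / _).
  apply/seteqP; split => y /=.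
    move=> [yv hist] s; rewrite /x' leq_eqVlt => /predU1P[->|].
      by rewrite ltnn.
    by rewrite ltnS => st; rewrite st hist.
  move=> hist; split; first by rewrite hist// /x' ltnn.
  by move=> s st; rewrite hist ?leqW// /x' st.
move: Hgt0; rewrite -/(history t x) !unit_prob_history// lte_fin => Hgt0.
rewrite /= big_nat_recr//= /x' leqnn ltnn.
rewrite (@eq_big_nat _ _ _ 0%N t _ (fun s => P (x s) (x s.+1))); last first.
  by move=> s /andP[_ st]; rewrite (ltnW st) st.
by rewrite mulrAC divff ?mul1r// gt_eqF.
Qed.

Lemma interval_chain_start :
  unit_prob R [set o | interval_chain 0%N o = u] = 1%E.
Proof.
rewrite (_ : [set o | _] = setT) ?probability_setT//.
by apply/seteqP; split => // y _ /=; rewrite /interval_chain /= if_same.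
Qed.

End IntervalRealisation.

(** * From hitting times to a bound on the killed form *)

Section HittingTimeBound.
Context {R : realType} {V : finType}.
Variable P : V -> V -> R.
Hypothesis tP : transition_matrix P.

Lemma t_hit_ge u w n :
  ((\sum_(0 <= k < n) survival (fun=> P) (fun=> w) k u)%:E <= t_hit P)%E.
Proof.
apply: (@le_trans _ _ (expected_hitting_time P u w)); last first.
  by apply: ereal_sup_ubound; exists (u, w).
apply: (@le_trans _ _ (\int[unit_prob R]_(o in setT)
    hitting_time (interval_chain P u) w o)%E).
  apply: expectation_hitting_time_ge; first exact: interval_chain_markov.
  exact: interval_chain_start.
apply: ereal_sup_ubound.
exists _, _, (unit_prob R), (interval_chain P u); split => //.
  exact: interval_chain_markov.
exact: interval_chain_start.
Qed.

Hypothesis V_gt1 : (1 < #|V|)%N.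
Hypothesis lazyP : lazy P.
Hypothesis hit_fin : (t_hit P < +oo)%E.

Lemma le_fine_t_hit (x : R) : (x%:E <= t_hit P)%E -> x <= fine (t_hit P).
Proof.
by case: (t_hit P) hit_fin => [r| |]//=; rewrite ?lee_fin// leeNy_eq.
Qed.

Lemma hitting_potential w : exists phi : V -> R,
  [/\ forall u, 0 <= phi u <= fine (t_hit P), phi w = 0 &
      forall u, u != w -> phi u = 1 + \sum_v P u v * phi v].
Proof.
apply: expected_hitting_time_equation => // n u.
exact/le_fine_t_hit/t_hit_ge.
Qed.

(** Off the target laziness gives [phi u >= 1 + phi u / 2]. The bound is what makes [1 - 1 / t_hit]
    positive later. *)
Lemma fine_t_hit_ge2 : 2 <= fine (t_hit P).
Proof.
have /card_gt1P[u [w [_ _ uw]]] := V_gt1.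
have [phi [phiH _ /(_ _ uw) phiE]] := hitting_potential w.
have /andP[_ phi_le] := phiH u.
apply: le_trans phi_le.
suff : 1 + 2^-1 * phi u <= phi u by lra.
rewrite [leRHS]phiE lerD2l (bigD1 u)//= ler_wpDr//.
  apply: sumr_ge0 => v _; apply: mulr_ge0; last by have /andP[] := phiH v.
  by have [/(_ u v)/andP[]] := tP.
by apply: ler_wpM2r (lazyP u); have /andP[] := phiH u.
Qed.

Lemma killed_form_bound (pi : V -> R) w f :
  (forall u, 0 <= pi u) -> reversible pi P -> f w = 0 ->
  transition_form pi P f f <= (1 - (fine (t_hit P))^-1) * l2norm2 pi f.
Proof.
move=> pi_ge0 revP fw.
have [phi [phiH phiw phiE]] := hitting_potential w.
have H_gt0 : 0 < fine (t_hit P) by have := fine_t_hit_ge2; lra.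
have P_phi_ge0 u : 0 <= \sum_v P u v * phi v.
  apply: sumr_ge0 => v _; apply: mulr_ge0; last by have /andP[] := phiH v.
  by have [/(_ u v)/andP[]] := tP.
apply: (supersolution_bound pi_ge0 tP revP (phi := phi) (w := w)) => //.
- by move=> u; have /andP[] := phiH u.
- by move=> u uw; rewrite phiE//; have := P_phi_ge0 u; lra.
move=> u uw; have := phiE _ uw.
(* Since [phi] is at most [t_hit], subtracting 1 from it removes at least the fraction
   [1 / t_hit]. *)
have : (fine (t_hit P))^-1 * phi u <= 1.
  by rewrite mulrC ler_pdivrMr// mul1r; have /andP[] := phiH u.
lra.
Qed.

End HittingTimeBound.

(** * The stationary walk and the final estimate *)

(** The variance of [f] under [pi] is nonnegative. *)
Lemma sqr_mean_le {R : realType} {V : finType} (pi f : V -> R) :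
  (forall v, 0 <= pi v) -> \sum_v pi v = 1 ->
  (\sum_v pi v * f v) ^+ 2 <= l2norm2 pi f.
Proof.
move=> pi_ge0 pi1.
have sqE c : \sum_v pi v * (f v - c) ^+ 2 =
    l2norm2 pi f - 2 * c * (\sum_v pi v * f v) + c ^+ 2 * (\sum_v pi v).
  rewrite /l2norm2 !mulr_sumr -sumrB -big_split; apply: eq_bigr => v _ /=.
  by ring.
have : 0 <= \sum_v pi v * (f v - \sum_v pi v * f v) ^+ 2.
  by apply: sumr_ge0 => v _; rewrite mulr_ge0// sqr_ge0.
by rewrite sqE pi1; lra.
Qed.

(** Reversibility carries [pi] through each kernel and so turns the forward recursion of the mass
    into the backward one of [survival]. *)
Lemma avoid_mass_stationary {R : realType} {V : finType} d
    (Omega : measurableType d) (Pr : probability Omega R)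
    (P : nat -> V -> V -> R) (pi : V -> R) (X : nat -> Omega -> V)
    (w : nat -> V) t v :
  markov_chain Pr P X -> (forall t : nat, (1 <= t)%N -> reversible pi (P t)) ->
  (forall v, Pr [set o | X 0%N o = v] = (pi v)%:E) ->
  avoid_mass Pr X w t v = pi v * survival P w t v.
Proof.
move=> hX revP hX0; elim: t v => [|t IHt] v.
  by rewrite avoid_mass0 hX0 mulrC.
rewrite (avoid_massS hX) /= mulrCA; congr (_ * _).
rewrite mulr_sumr; apply: eq_bigr => u _.
by rewrite IHt mulrAC revP// mulrA.
Qed.

Theorem lemma1p12 (R : realType) (V : finType) (hV : (2 <= #|V|)%N)
  (P : nat -> V -> V -> R) (pi : V -> R)
  (hP : forall t : nat, (1 <= t)%N ->
     [/\ transition_matrix (P t), irreducible (P t), lazy (P t),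
         stationary pi (P t) & reversible pi (P t)])
  (hHIT : (t_HIT P < +oo)%E)
  (d : measure_display) (Omega : measurableType d) (Pr : probability Omega R)
  (X : nat -> Omega -> V)
  (hX : markov_chain Pr P X)
  (hX0 : forall v : V, Pr [set o | X 0%N o = v] = (pi v)%:E)
  (w : nat -> V) (T : nat) :
  (Pr [set o | forall t : nat, (t <= T)%N -> X t o <> w t]
     <= (\prod_(1 <= t < T.+1) (1 - (fine (t_hit (P t)))^-1))%:E)%E
  /\
  \prod_(1 <= t < T.+1) (1 - (fine (t_hit (P t)))^-1)
     <= expR (- (T%:R / fine (t_HIT P))).
Proof.
have hit_HIT t : (1 <= t)%N -> (t_hit (P t) <= t_HIT P)%E.
  by move=> t1; apply: ereal_sup_ubound; exists t.
have hit_fin t : (1 <= t)%N -> (t_hit (P t) < +oo)%E.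
  by move=> t1; exact: le_lt_trans (hit_HIT _ t1) hHIT.
have hit2 t : (1 <= t)%N -> 2 <= fine (t_hit (P t)).
  move=> t1; have [tP _ lP _ _] := hP _ t1.
  by apply: fine_t_hit_ge2 => //; exact: hit_fin.
pose beta t := 1 - (fine (t_hit (P t)))^-1.
have beta_gt0 t : (1 <= t)%N -> 0 < beta t.
  by move=> /hit2 h2; rewrite subr_gt0 invf_lt1; lra.
have [_ _ _ [pi_ge0 pi1 _] _] := hP 1%N (leqnn _).
split; last first.
  have -> : - (T%:R / fine (t_HIT P)) =
      \sum_(1 <= t < T.+1) - (fine (t_HIT P))^-1.
    by rewrite sumr_const_nat subn1 mulNrn mulr_natl.
  rewrite expR_sum big_nat_cond [leRHS]big_nat_cond.
  apply: ler_prod => t /andP[/andP[t1 _] _].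
  rewrite (ltW (beta_gt0 t t1)) /=.
  (* [1 + x <= expR x] at [x = - 1 / t_hit (P t)]; monotonicity of [expR] then replaces [t_hit] by
     [t_HIT]. *)
  apply: le_trans (expR_ge1Dx _) _.
  have hit_le : fine (t_hit (P t)) <= fine (t_HIT P).
    have := hit_HIT _ t1; have := hit_fin _ t1; have := hit2 _ t1.
    case: (t_hit (P t)) => [r| |]//=; last by rewrite lt_geF.
    by case: (t_HIT P) hHIT => [s| |].
  have h2 := hit2 _ t1.
  by rewrite ler_expR lerN2 lef_pV2 ?posrE//; lra.
have norm_le t : l2norm2 pi (survival P w t) <= (\prod_(1 <= s < t.+1) beta s) ^+ 2.
  elim: t => [|t IHt].
    rewrite big_geq// expr1n -pi1; apply: ler_sum => v _ /=.
    rewrite ler_piMr//; case: (_ != _); rewrite ?expr0n ?expr1n//.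
  have [tP _ lP _ rP] := hP t.+1 isT.
  have bt := beta_gt0 t.+1 isT.
  have surv0 s : survival P w s (w s) = 0.
    by case: s => [|s] /=; rewrite eqxx ?mul0r.
  (* Left general in the target: it is applied to the old function, zero at [w t], and to the new
     one, zero at [w t.+1]. This is how a moving target is handled with one [beta]. *)
  have kfb := killed_form_bound tP hV lP (hit_fin t.+1 isT) pi_ge0 rP.
  have step : l2norm2 pi (survival P w t.+1) <=
      beta t.+1 ^+ 2 * l2norm2 pi (survival P w t).
    apply: (killed_step_contraction pi_ge0 tP rP (w := w t.+1)) => //.
    - exact: kfb (surv0 t).
    - exact: kfb (surv0 t.+1).
  apply: le_trans step _.
  by rewrite big_nat_recr//= exprMn mulrC ler_wpM2r// sqr_ge0.
have -> : Pr [set o | forall t : nat, (t <= T)%N -> X t o <> w t] =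
    (\sum_v pi v * survival P w T v)%:E.
  rewrite -[LHS]fineK; last first.
    by apply: fin_num_measure; exact: (measurable_avoids hX).
  congr (_%:E); rewrite (prob_avoids hX); apply: eq_bigr => v _.
  rewrite (avoid_mass_stationary _ _ _ hX (pi := pi))// => t t1.
  by have [] := hP t t1.
rewrite lee_fin.
have prod_ge0 : 0 <= \prod_(1 <= s < T.+1) beta s.
  by rewrite big_nat_cond prodr_ge0// => s /andP[/andP[/beta_gt0/ltW]].
have : (\sum_v pi v * survival P w T v) ^+ 2 <= (\prod_(1 <= s < T.+1) beta s) ^+ 2.
  exact: le_trans (sqr_mean_le _ pi_ge0 pi1) (norm_le T).
(* The squares compare the numbers themselves because the product is nonnegative. *)
by case: leP => // lt_prod; nra.
Qed.
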